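(* Let $-1\le\alpha<0$ and $n\ge 4$. Among all connected unicyclic graphs on $n$ vertices, the cycle $C_n$ is the unique graph with maximum general sum-connectivity index $\chi_\alpha$, which equals $n4^\alpha$. For $n=4$, the graph $U_{4,3}$ (a triangle with one pendant vertex attached) is the unique graph with the second largest value of $\chi_\alpha$, equal to $2\cdot 4^\alpha+2\cdot 5^\alpha$. For $n\ge 5$, the graphs with the second largest value of $\chi_\alpha$ are exactly the graphs obtained from a cycle $C_l$ with $3\le l\le n-2$ by attaching a path on $n-l\ge 2$ vertices to one vertex of the cycle, and this second largest value equals $(n-4)4^\alpha+3\cdot5^\alpha+3^\alpha$.
   Context: All graphs are finite and simple; $d(v)$ denotes the degree of $v$. A unicyclic graph is a connected graph with exactly one cycle. The general sum-connectivity index is $\chi_\alpha(G)=\sum_{uv\in E(G)}(d(u)+d(v))^\alpha$. Attaching a path $P_r$ (path on $r$ vertices) to a vertex $v$ means adding a disjoint copy of $P_r$ and an edge between $v$ and a terminal vertex of the path. *)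

(* Defs.v *)
From Stdlib Require Import Reals.
From mathcomp Require Import all_boot.
Set Implicit Arguments. Unset Strict Implicit. Unset Printing Implicit Defensive.

Definition graph (n : nat) := {set {set 'I_n}}.

Definition simple_graph n (E : graph n) : Prop :=
  forall e, e \in E -> #|e| = 2.

Definition adj n (E : graph n) : rel 'I_n := fun u v => [set u; v] \in E.

Definition deg n (E : graph n) (v : 'I_n) : nat := #|[set e in E | v \in e]|.

Definition connected n (E : graph n) : Prop :=
  forall u v : 'I_n, connect (adj E) u v.

Definition is_cycle_in n (E C : graph n) : Prop :=
  [/\ C \subset E, C != set0,
      forall v, deg C v = 0 \/ deg C v = 2
    & forall u v, 0 < deg C u -> 0 < deg C v -> connect (adj C) u v].

Definition unicyclic n (E : graph n) : Prop :=
  connected E /\ exists C, is_cycle_in E C /\ forall C', is_cycle_in E C' -> C' = C.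

Definition iso n (E1 E2 : graph n) : Prop :=
  exists f : 'I_n -> 'I_n, injective f /\ [set f @: (e : {set 'I_n}) | e in E1] = E2.

(* tadpole n l : the cycle C_l on vertices 0..l-1 with the path P_{n-l}
   on vertices l..n-1 attached (by the edge {l-1, l}) to vertex l-1.
   Edges: {i, i+1} for i+1 < n, together with {0, l-1}. *)
Definition tadpole n (l : nat) : graph n :=
  [set e : {set 'I_n} | [exists i : 'I_n, exists j : 'I_n,
     (e == [set i; j]) &&
     ((val j == (val i).+1) || ((val i == 0) && (val j == l.-1)))]].

Definition cycle_graph n : graph n := tadpole n n.

Definition chi (alpha : R) n (E : graph n) : R :=
  \big[Rplus/R0]_(e in E) Rpower (INR (\sum_(v in e) deg E v)%N) alpha.

(* Main.v *)
Require Import Defs.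
From HB Require Import structures.
From Stdlib Require Import Reals Lra.
From mathcomp Require Import all_boot zify.
Set Implicit Arguments. Unset Strict Implicit. Unset Printing Implicit Defensive.

(* Write f(s) = s^alpha, g = f(3) - f(4), h = f(4) - f(5) and sigma = h - g/3 > 0.
   Summing 1/d(u) + 1/d(v) over the edges of a graph without isolated vertices
   gives n, so subtracting 2g(1 - 1/x - 1/y) from the weight of an edge with end
   degrees x and y changes nothing in total when there are n edges.  Concavity
   of t |-> t^(-alpha) yields
     f(x + y) <= f(4) - 2g(1 - 1/x - 1/y) - tau,
   where tau is sigma if x or y is at least 3 and 0 otherwise; the inequality is
   strict when x + y >= 6.  A vertex of degree at least 3 lies on at least three
   edges, so every unicyclic graph other than the cycle has index at most
     n f(4) - 3 sigma = (n - 4) f(4) + 3 f(5) + f(3),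
   and equality forces a single vertex of degree 3 and no vertex of larger degree.
   Such a graph is a tadpole: a longest path whose starting vertex has a chord to
   the path must be Hamiltonian, and there are no further edges. *)

(** * Degrees and connectivity *)

Definition nbrs n (E : graph n) (v : 'I_n) : {set 'I_n} := [set w | adj E v w].

Lemma adj_sym n (E : graph n) : symmetric (adj E).
Proof. by move=> u v; rewrite /adj setUC. Qed.

Lemma adj_neq n (E : graph n) u v : simple_graph E -> adj E u v -> u != v.
Proof. by move=> sE /sE; rewrite cards2; case: eqP. Qed.

Lemma edgeP n (E : graph n) e : simple_graph E -> e \in E ->
  exists u v, [/\ u != v, e = [set u; v] & adj E u v].
Proof.
move=> sE eE; have /eqP/cards2P[u [v [neq_uv def_e]]] := sE e eE.
by exists u, v; split=> //; rewrite /adj -def_e.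
Qed.

Lemma set2_inj (T : finType) (v : T) : injective (fun w => [set v; w]).
Proof.
move=> w w' /setP eq_vw; have := eq_vw w; have := eq_vw w'.
rewrite !inE !eqxx !orbT => /orP[/eqP->|/eqP->//].
by rewrite orbb => /esym/eqP.
Qed.

Lemma deg_nbrs n (E : graph n) v : simple_graph E -> deg E v = #|nbrs E v|.
Proof.
move=> sE; rewrite /deg -(card_imset _ (@set2_inj _ v)).
apply: eq_card => e; rewrite !inE; apply/andP/imsetP => [[eE ve]|[w]].
  have [x [y [_ def_e xy]]] := edgeP sE eE.
  move: ve; rewrite def_e !inE => /orP[]/eqP->; first by exists y; rewrite ?inE.
  by exists x; rewrite 1?setUC // inE adj_sym.
by rewrite inE => vw ->; rewrite !inE eqxx.
Qed.

Lemma leq_deg n (E : graph n) v s : simple_graph E -> uniq s ->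
  all (adj E v) s -> size s <= deg E v.
Proof.
move=> sE us sv; rewrite deg_nbrs // -(card_uniqP us); apply/subset_leq_card/subsetP => w.
by move=> /(allP sv); rewrite inE.
Qed.

Lemma deg_sub n (C E : graph n) v : C \subset E -> deg C v <= deg E v.
Proof.
move=> /subsetP CE; apply/subset_leq_card/subsetP => e.
by rewrite !inE => /andP[/CE-> ->].
Qed.

Lemma simple_sub n (C E : graph n) : C \subset E -> simple_graph E -> simple_graph C.
Proof. by move=> /subsetP CE sE e /CE/sE. Qed.

Lemma deg_gt0 n (E : graph n) e v : e \in E -> v \in e -> 0 < deg E v.
Proof. by move=> eE ve; apply/card_gt0P; exists e; rewrite inE eE. Qed.

(** A set that no edge leaves is closed under adjacency, so in a connected graph it cannot contain
    [x] and miss [y]. *)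
Lemma connected_exit n (E : graph n) (X : {set 'I_n}) x y :
  connected E -> x \in X -> y \notin X ->
  exists u v, [/\ u \in X, v \notin X & adj E u v].
Proof.
move=> cE xX yX.
case: (boolP [exists u in X, exists v in ~: X, adj E u v]) => [/existsP[u /andP[uX]]|noX].
  by case/existsP=> v /andP[]; rewrite inE => vX uv; exists u, v.
have clX : closed (adj E) X.
  apply: intro_closed; first exact/sym_connect_sym/adj_sym.
  move=> u v uv uX; apply: contraNT noX => vX.
  by apply/existsP; exists u; rewrite uX; apply/existsP; exists v; rewrite inE vX.
by have := closed_connect clX (cE x y); rewrite xX (negPf yX).
Qed.

Lemma connected_deg_gt0 n (E : graph n) v :
  1 < n -> simple_graph E -> connected E -> 0 < deg E v.
Proof.
move=> n_gt1 sE cE.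
have [w wv] : exists w, w \notin [set v].
  apply/existsP; rewrite -negb_forall; apply/negP => /forallP all_v.
  have : #|[set: 'I_n]| <= #|[set v]| by apply/subset_leq_card/subsetP.
  by rewrite cardsT card_ord cards1 leqNgt n_gt1.
have [u [y [/set1P-> _ vy]]] := connected_exit cE (set11 v) wv.
by apply: (deg_gt0 vy); rewrite !inE eqxx.
Qed.

Lemma deg1_nbr n (E : graph n) u v w : simple_graph E -> deg E u = 1 ->
  adj E u v -> adj E u w -> w = v.
Proof.
move=> sE du uv uw; apply/eqP; apply: contraT => vw.
have := @leq_deg _ E u [:: w; v] sE; rewrite du /= inE vw uv uw /=.
by move/(_ isT isT).
Qed.

(** Two adjacent vertices of degree 1 would form a whole component, but a third vertex exists. This
    removes the degree pair (1, 1) from the edge estimate. *)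
Lemma connected_edge_deg n (E : graph n) u v :
  2 < n -> simple_graph E -> connected E -> adj E u v -> 2 < deg E u + deg E v.
Proof.
move=> n_gt2 sE cE uv; rewrite ltnNge; apply/negP => le2.
have du := connected_deg_gt0 u (ltnW n_gt2) sE cE.
have dv := connected_deg_gt0 v (ltnW n_gt2) sE cE.
have [du1 dv1] : deg E u = 1 /\ deg E v = 1 by lia.
have [w wuv] : exists w, w \notin [set u; v].
  apply/existsP; rewrite -negb_forall; apply/negP => /forallP all_uv.
  have : #|[set: 'I_n]| <= #|[set u; v]| by apply/subset_leq_card/subsetP.
  by rewrite cardsT card_ord cards2; case: (u == v) => /=; lia.
have [x [y [+ yuv xy]]] := connected_exit cE (set21 u v) wuv.
rewrite !inE in yuv *; case/pred2P => ?; subst x.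
  by rewrite (deg1_nbr sE du1 uv xy) eqxx orbT in yuv.
by rewrite adj_sym in uv; rewrite (deg1_nbr sE dv1 uv xy) eqxx in yuv.
Qed.

(* A lasso is a path x_0, ..., x_k whose starting vertex x_0 is also joined to
   x_{l-1}, that is, a possibly partial copy of a tadpole. *)
Definition lasso n (E : graph n) l (p : seq 'I_n) : Prop :=
  [/\ uniq p, 2 < l <= size p,
      forall x0 i, i.+1 < size p -> adj E (nth x0 p i) (nth x0 p i.+1)
    & forall x0, adj E (nth x0 p 0) (nth x0 p l.-1)].

Lemma uniq_size_ord n (p : seq 'I_n) : uniq p -> size p <= n.
Proof. by move=> /card_uniqP <-; rewrite -[leqRHS](card_ord n) max_card. Qed.

(** Take a longest path. Its first vertex has a neighbour other than the second vertex, and by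
    maximality this neighbour lies on the path, which gives the chord. *)
Lemma exists_lasso n (E : graph n) : simple_graph E -> E != set0 ->
  (forall v, deg E v != 1) -> exists l p, lasso E l p.
Proof.
move=> sE /set0Pn[e eE] deg_n1; have [a [b [ab _ abE]]] := edgeP sE eE.
pose P m := [exists p : m.-tuple 'I_n, uniq p && sorted (adj E) p].
have Pseq (s : seq 'I_n) : uniq s -> sorted (adj E) s -> P (size s).
  by move=> us ss; apply/existsP; exists (in_tuple s); rewrite us.
have P2 : P 2 by apply: (Pseq [:: a; b]); rewrite /= ?inE ?ab ?abE.
have ubP m : P m -> m <= n.
  by case/existsP => p /andP[/uniq_size_ord]; rewrite size_tuple.
case: (ex_maxnP (ex_intro P 2 P2) ubP) => m /existsP[[p /= /eqP szp] /andP[up sp]] maxm.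
have := maxm _ P2; case: p szp up sp => [|x [|y q]] szp up sp; rewrite -szp // => _.
have xy : adj E x y by case/andP: sp.
have [z [xz zy]] : exists z, adj E x z /\ z != y.
  have /card_gt0P[z] : 0 < #|nbrs E x :\ y|.
    have := cardsD1 y (nbrs E x); rewrite -deg_nbrs // inE xy.
    by move=> dx; have := deg_n1 x; rewrite dx; case: #|_|.
  by rewrite !inE => /andP[zy xz]; exists z.
have zp : z \in [:: x, y & q].
  apply: contraT => zp; have := maxm _ (Pseq (z :: [:: x, y & q]) _ _).
  by rewrite -szp ltnn; apply; rewrite ?cons_uniq ?zp //= adj_sym xz.
exists (index z [:: x, y & q]).+1, [:: x, y & q]; split=> //.
- have xz' := adj_neq sE xz.
  rewrite index_mem zp andbT /= (negPf xz') [y == z]eq_sym (negPf zy) //.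
- by move=> x0 i; apply/sortedP.
- by move=> x0; rewrite /= -/(index z [:: x, y & q]) nth_index.
Qed.

(** * Cycle subgraphs from closed sequences *)

Definition cycle_edges n (p : seq 'I_n) : graph n := [set [set x; next p x] | x in p].

(** Rotate [p] so that it starts at [x]: the successor is then the second entry and the predecessor
    the last, and these are different positions. This makes the degrees in [cycle_edges] exactly
    2. *)
Lemma next_neq_prev (T : eqType) (p : seq T) x :
  uniq p -> 2 < size p -> x \in p -> next p x != prev p x.
Proof.
move=> up szp xp; have [i [|y [|z q]] def_p] := rot_to xp.
- by have := congr1 size def_p; rewrite size_rot => sz; rewrite sz in szp.
- by have := congr1 size def_p; rewrite size_rot => sz; rewrite sz in szp.
rewrite -(next_rot i up) -(prev_rot i up) def_p.
have := up; rewrite -(rot_uniq i) def_p => /and3P[xq yq _].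
move: xq; rewrite inE negb_or => /andP[/negPf xy xz].
have -> : prev [:: x, y, z & q] x = last z q.
  rewrite /= xy; elim: q y z xz {up def_p yq xy} => [|w q IHq] y z; rewrite in_cons negb_or => /andP[/negPf/= ->].
    by rewrite eqxx.
  exact: IHq.
by rewrite /= eqxx; apply: contraNneq yq => ->; apply: mem_last.
Qed.

Lemma is_cycle_cycle_edges n (p : seq 'I_n) (E : graph n) : 
  uniq p -> 2 < size p -> cycle (adj E) p -> is_cycle_in E (cycle_edges p).
Proof.
move=> up szp cp.
have deg_in v : v \in p -> deg (cycle_edges p) v = 2.
  move=> vp; rewrite /deg.
  suff -> : [set e in cycle_edges p | v \in e] = [set [set v; next p v]; [set v; prev p v]].
    by rewrite cards2 (inj_eq (@set2_inj _ v)) next_neq_prev.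
  apply/setP => e; rewrite !inE; apply/andP/pred2P => [[/imsetP[x xp ->]]|[]->].
  - by rewrite !inE => /pred2P[]->; [left|right; rewrite prev_next // setUC].
  - by rewrite !inE eqxx (imset_f (fun w => [set w; next p w]) vp).
  rewrite !inE eqxx; split=> //; apply/imsetP; exists (prev p v); first by rewrite mem_prev.
  by rewrite next_prev // setUC.
have deg_out v : 0 < deg (cycle_edges p) v -> v \in p.
  case/card_gt0P => e; rewrite inE => /andP[/imsetP[x xp ->]].
  by rewrite !inE => /pred2P[]->; rewrite ?mem_next.
split.
- apply/subsetP => e /imsetP[x xp ->]; exact: (next_cycle cp xp).
- case: p szp {up cp deg_in deg_out} => // x p _; apply/set0Pn; exists [set x; next (x :: p) x].
  by apply: (imset_f (fun w => [set w; next (x :: p) w])); rewrite inE eqxx.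
- move=> v; case: (posnP (deg (cycle_edges p) v)) => [->|/deg_out/deg_in]; first by left.
  by right.
move=> u v /deg_out up' /deg_out vp; apply: (connect_cycle _ up' vp).
apply: (cycle_from_next up) => x xp; exact: (imset_f (fun w => [set w; next p w])).
Qed.

Lemma lasso_take_cycle n (E : graph n) l p : lasso E l p -> cycle (adj E) (take l p).
Proof.
case=> up /andP[l2 lp] stepE chordE.
case: l l2 lp chordE => // l l2 lp chordE; case: p up lp stepE chordE => // x p up lp stepE chordE.
rewrite /= rcons_path; apply/andP; split.
  apply/(pathP x) => i; rewrite size_takel // => il.
  rewrite -[x :: take l p]/(take l.+1 (x :: p)) !nth_take ?(ltnW il) //; last exact: leqW.
  by apply: (stepE x); apply: leq_ltn_trans il lp.
rewrite (last_nth x) size_takel // -[x :: take l p]/(take l.+1 (x :: p)) nth_take //.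
by rewrite adj_sym; apply: (chordE x).
Qed.

Lemma lasso_cycle n (E : graph n) l p : lasso E l p -> is_cycle_in E (cycle_edges (take l p)).
Proof.
move=> lasso_p; have [up /andP[l2 lp] _ _] := lasso_p.
by apply: is_cycle_cycle_edges (lasso_take_cycle lasso_p); rewrite ?take_uniq ?size_takel.
Qed.

(** * Edge counts and uniqueness of the cycle *)

Definition supp n (E : graph n) : {set 'I_n} := [set v | 0 < deg E v].

(** Induction on the number of edges. Without a vertex of degree 1 there would be a lasso, hence a
    cycle; deleting the edge at such a vertex removes the vertex from the support. Counting only
    non-isolated vertices lets the induction run without connectedness. *)
Lemma acyclic_card n (E : graph n) : simple_graph E -> (forall C, ~ is_cycle_in E C) ->
  E != set0 -> #|E| < #|supp E|.
Proof.
elim: {E}_.+1 {-2}E (ltnSn #|E|) => // m IHm E leEm sE acE En0.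
have [v /eqP dv] : exists v, deg E v == 1.
  apply/existsP; apply: contraT => /existsPn/(exists_lasso sE En0)[l [p /lasso_cycle]].
  by move/acE.
have [e def_e] : exists e, [set e in E | v \in e] = [set e] by apply/cards1P/eqP.
have [eE ve] : e \in E /\ v \in e by have := set11 e; rewrite -def_e inE => /andP.
have sF : E :\ e \subset E by apply: subsetDl.
have vE : v \in supp E by rewrite inE dv.
have suppF : supp (E :\ e) \subset supp E :\ v.
  apply/subsetP => w; rewrite !inE => dw; rewrite (leq_trans dw (deg_sub _ sF)) andbT.
  apply: contraTneq dw => ->; rewrite -leqNgt leqn0 cards_eq0; apply/eqP/setP => e'.
  have := congr1 (fun A : {set _} => e' \in A) def_e; rewrite !inE => <-.
  by case: (e' \in E); case: (v \in e').
rewrite (cardsD1 e) eE (cardsD1 v (supp E)) vE !add1n ltnS.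
have [->|F0] := eqVneq (E :\ e) set0.
  rewrite cards0; have [x [y [xy def_xy xyE]]] := edgeP sE eE.
  have [w [we wv]] : exists w, w \in e /\ w != v.
    move: ve; rewrite def_xy !inE => /pred2P[]->; first by exists y; rewrite !inE eqxx orbT eq_sym.
    by exists x; rewrite !inE eqxx.
  by apply/card_gt0P; exists w; rewrite !inE wv (deg_gt0 eE).
apply: leq_trans (subset_leq_card suppF); apply: IHm => //.
- by rewrite (cardsD1 e) eE ltnS in leEm.
- exact: simple_sub sF sE.
move=> C [CF *]; apply: (acE C); split=> //; exact: subset_trans CF sF.
Qed.

(** Deleting one edge of the unique cycle leaves an acyclic graph, to which [acyclic_card]
    applies. *)
Lemma unicyclic_card n (E : graph n) : 0 < n -> simple_graph E -> unicyclic E -> #|E| <= n.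
Proof.
move=> n_gt0 sE [cE [C [[CE /set0Pn[e eC] dC cC] uC]]].
have eE := subsetP CE e eC.
have sF : E :\ e \subset E by apply: subsetDl.
rewrite (cardsD1 e) eE add1n.
have [->|F0] := eqVneq (E :\ e) set0; first by rewrite cards0.
apply: leq_trans (acyclic_card (simple_sub sF sE) _ F0) _; last first.
  by rewrite -[leqRHS](card_ord n) max_card.
move=> C' [C'F C'0 dC' cC']; have C'C : C' = C.
  by apply: uC; split=> //; exact: subset_trans C'F sF.
by have := subsetP C'F e; rewrite C'C !inE eqxx; move/(_ eC).
Qed.

(** At a vertex of [C] the two edges of [C] already exhaust the degree in [K]. Hence [supp C] is
    closed under adjacency in [K], and the connectedness of [K] spreads [C] over all of [K]. *)
Lemma cycle_eq n (C K : graph n) : simple_graph K -> 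
  C \subset K -> C != set0 -> (forall v, deg C v = 0 \/ deg C v = 2) ->
  (forall v, deg K v <= 2) -> (forall u v, 0 < deg K u -> 0 < deg K v -> connect (adj K) u v) ->
  C = K.
Proof.
move=> sK CK C0 dC dK cK; apply/eqP; rewrite eqEsubset CK /=.
have full v : 0 < deg C v -> [set e in C | v \in e] = [set e in K | v \in e].
  move=> dv; apply/eqP; rewrite eqEcard; apply/andP; split.
    by apply/subsetP => e; rewrite !inE => /andP[/(subsetP CK)->].
  by rewrite -[X in X <= _]/(deg K v) -[X in _ <= X]/(deg C v); case: (dC v) dv => -> // _; apply: dK.
have clC : closed (adj K) (supp C).
  apply: intro_closed; first exact/sym_connect_sym/adj_sym.
  move=> x y xy; rewrite !inE => /full/setP/(_ [set x; y]).
  by rewrite !inE eqxx [_ \in K]xy andbT /= => xyC; apply: (deg_gt0 (e := [set x; y])); rewrite ?xyC // set22.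
apply/subsetP => e eK; have [x [y [xy def_e xyK]]] := edgeP sK eK.
have [e0 e0C] := set0Pn _ C0.
have [x0 [y0 [_ def_e0 x0C]]] := edgeP (simple_sub CK sK) e0C.
have dx0 : 0 < deg C x0 by apply: (deg_gt0 x0C); rewrite set21.
have : x \in supp C.
  rewrite -(closed_connect clC (cK x0 x _ _)) ?inE ?(leq_trans dx0 (deg_sub _ CK)) //.
  by apply: (deg_gt0 eK); rewrite def_e set21.
by rewrite inE => /full/setP/(_ e); rewrite !inE eK def_e set21 /= andbT => ->.
Qed.

(** * Longest lassos *)

Lemma cycle_lasso n (E : graph n) p :
  uniq p -> 2 < size p -> cycle (adj E) p -> lasso E (size p) p.
Proof.
case: p => // x p up sp /(pathP x) pE; split; rewrite ?leqnn ?andbT //.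
  move=> x0 i; rewrite ltnS => ip; have iSp : i < size (x :: p) by apply: leqW.
  have := pE i; rewrite size_rcons -rcons_cons !nth_rcons ip iSp => /(_ isT).
  by rewrite (set_nth_default x0 x iSp) (set_nth_default x0 x ip).
move=> x0; have := pE (size p); rewrite size_rcons -rcons_cons !nth_rcons ltnn eqxx leqnn adj_sym => /(_ isT).
by rewrite (set_nth_default (s := x :: p) x0 x) // leqnn.
Qed.

Lemma lasso_rot n (E : graph n) i p : lasso E (size p) p -> lasso E (size p) (rot i p).
Proof.
move=> lp; have := lasso_take_cycle lp; case: lp => up /andP[sp _] _ _.
rewrite take_size -(rot_cycle i) => cp; rewrite -(size_rot i).
by apply: cycle_lasso; rewrite ?rot_uniq ?size_rot.
Qed.

Lemma lasso_rcons n (E : graph n) l p v : lasso E l p -> v \notin p ->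
  (forall x0, adj E (last x0 p) v) -> lasso E l (rcons p v).
Proof.
case=> up /andP[l2 lp] stepE chordE vp pv; split.
- by rewrite rcons_uniq vp.
- by rewrite size_rcons l2 leqW.
- move=> x0 i; rewrite size_rcons ltnS leq_eqVlt => /predU1P[ip|ip]; rewrite !nth_rcons; last first.
    by rewrite ip (ltnW ip) stepE.
  by rewrite ip ltnn eqxx -ip leqnn -[X in nth _ _ X]/(i.+1.-1) ip nth_last.
have [p_gt0 pl] : 0 < size p /\ l.-1 < size p by lia.
by move=> x0; rewrite !nth_rcons p_gt0 pl; apply: chordE.
Qed.

(** Some [u] on the lasso has a neighbour [v] outside it. If [u] is last, or can be rotated to the
    end, append [v]. Otherwise [x_(l-1)] has degree at least 3 from its two path neighbours and the
    chord, so [u] is either a vertex of degree 4 or a second vertex of degree at least 3. *)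
Lemma lasso_extend n (E : graph n) l p :
    simple_graph E -> connected E ->
    (forall v, deg E v <= 3) -> (forall u v, 2 < deg E u -> 2 < deg E v -> u = v) ->
  lasso E l p -> size p < n -> exists l' p', lasso E l' p' /\ size p' = (size p).+1.
Proof.
move=> sE cE d3 u3 lasso_p pn; have [up /andP[l2 lp] stepE chordE] := lasso_p.
have [y yp] : exists y, y \notin [set x in p].
  apply/existsP; rewrite -negb_forall; apply/negP => /forallP all_p.
  have : #|[set: 'I_n]| <= #|[set x in p]| by apply/subset_leq_card/subsetP.
  by rewrite cardsT card_ord cardsE (card_uniqP up) leqNgt pn.
have [x xp] : exists x, x \in [set x in p].
  by case: p lp {up lasso_p pn yp stepE chordE} => [|x p] lp; [by case: l l2 lp | exists x; rewrite !inE eqxx].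
have [u [v []]] := connected_exit cE xp yp; rewrite !inE => u_p vp uv.
pose i := index u p; have ip : i < size p by rewrite index_mem.
have iu x0 : nth x0 p i = u by apply: nth_index.
have [i_last|i_nlast] := eqVneq i.+1 (size p).
  exists l, (rcons p v); rewrite size_rcons; split=> //; apply: lasso_rcons => // x0.
  by rewrite -nth_last -i_last iu.
(* Here the lasso is a closed cycle, and rotating by [i.+1] makes [u] its last vertex. *)
have [lp_eq|l_neq] := eqVneq l (size p).
  exists l, (rcons (rot i.+1 p) v); rewrite size_rcons size_rot; split=> //.
  rewrite lp_eq in lasso_p *; apply: lasso_rcons; rewrite ?mem_rot //; first exact: lasso_rot.
  by move=> x0; rewrite /rot last_cat (take_nth x0) // last_rcons iu.
have {i_nlast}i_lt : i.+1 < size p by rewrite ltn_neqAle i_nlast.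
have {l_neq}l_lt : l < size p by rewrite ltn_neqAle l_neq.
pose x_ := nth u p.
have x_eq a b : a < size p -> b < size p -> (x_ a == x_ b) = (a == b).
  by move=> *; apply: nth_uniq.
have v_neq a : a < size p -> (x_ a == v) = false.
  by move=> ap; apply: contraNF vp => /eqP<-; apply: mem_nth.
have x_i : x_ i = u := iu u.
have x_step a b : b = a.+1 -> b < size p -> adj E (x_ a) (x_ b) by move=> ->; apply: stepE.
have x_step' a b : b = a.+1 -> b < size p -> adj E (x_ b) (x_ a) by rewrite adj_sym; apply: x_step.
have x_chord : adj E (x_ l.-1) (x_ 0) by rewrite adj_sym; apply: chordE.
have chord_deg : 2 < deg E (x_ l.-1).
  apply: (@leq_deg _ E _ [:: x_ l.-2; x_ l; x_ 0]) => //=.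
    by rewrite !inE !x_eq; lia.
  by apply/and4P; split=> //; [apply: x_step' | apply: x_step]; lia.
have [i_eq|i_neq] := eqVneq i l.-1.
  have : 3 < deg E (x_ l.-1).
    apply: (@leq_deg _ E _ [:: x_ l.-2; x_ l; x_ 0; v]) => //=.
      by rewrite !inE !v_neq ?x_eq; lia.
    have -> : adj E (x_ l.-1) v by rewrite -i_eq x_i.
    rewrite x_chord !andbT; by apply/andP; split; [apply: x_step' | apply: x_step]; lia.
  by rewrite ltnNge d3.
suff /u3/(_ chord_deg)/eqP : 2 < deg E (x_ i) by rewrite x_eq; lia.
(* The starting vertex has no predecessor on the path; the chord supplies its third neighbour. *)
have [i0|i_gt0] := posnP i.
  apply: (@leq_deg _ E _ [:: x_ i.+1; v; x_ l.-1]) => //=.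
    by rewrite !inE ![v == _]eq_sym !v_neq ?x_eq; lia.
  by rewrite x_step // {1}x_i uv i0 adj_sym x_chord.
apply: (@leq_deg _ E _ [:: x_ i.+1; v; x_ i.-1]) => //=.
  by rewrite !inE ![v == _]eq_sym !v_neq ?x_eq; lia.
by rewrite x_step // {1}x_i uv x_step' // prednK.
Qed.

Lemma hamiltonian_lasso n (E : graph n) l p :
    simple_graph E -> connected E ->
    (forall v, deg E v <= 3) -> (forall u v, 2 < deg E u -> 2 < deg E v -> u = v) ->
  lasso E l p -> exists l' p', lasso E l' p' /\ size p' = n.
Proof.
move=> sE cE d3 u3; have [k] := ubnP (n - size p); elim: k p l => // k IHk p l szp lp.
have pn : size p <= n by case: lp => /uniq_size_ord.
have [szp_n|szp_n] := eqVneq (size p) n; first by exists l, p.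
have [|l' [p' [lp' szp']]] := lasso_extend sE cE d3 u3 lp; first by lia.
by apply: IHk lp'; rewrite szp'; lia.
Qed.

(** * Tadpoles *)

(** Edges are indexed by vertices, with the last index reserved for the chord, so that the edge
    count is immediate and sums over edges become sums over ordinals. *)
Definition tadpole_edge m l (i : 'I_m.+1) : {set 'I_m.+1} :=
  if i < m then [set i; inord i.+1] else [set ord0; inord l.-1].

Lemma in_tadpole_edge m l (i v : 'I_m.+1) : l <= m.+1 ->
  (v \in tadpole_edge l i) =
  if i < m then (v == i :> nat) || (v == i.+1 :> nat)
  else (v == 0 :> nat) || (v == l.-1 :> nat).
Proof.
by move=> lm; rewrite /tadpole_edge; case: ifP => im; rewrite !inE -!val_eqE /= inordK //; lia.
Qed.

Lemma tadpole_edge_inj m l : 2 < l <= m.+1 -> injective (@tadpole_edge m l).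
Proof.
move=> /andP[l2 lm] i j /setP eq_ij; apply: val_inj => /=.
have hi := ltn_ord i; have hj := ltn_ord j.
have E v : v < m.+1 ->
    (if i < m then (v == i) || (v == i.+1) else (v == 0) || (v == l.-1)) =
    (if j < m then (v == j) || (v == j.+1) else (v == 0) || (v == l.-1)).
  by move=> vm; have := eq_ij (Ordinal vm); rewrite !in_tadpole_edge.
have l1m : l.-1 < m.+1 by lia.
(* Membership of the four vertices [i], [j], 0 and [l - 1] is enough to separate the two edges. *)
by have := E i hi; have := E j hj; have := E 0 isT; have := E _ l1m; do 2!case: ifP; lia.
Qed.

Lemma tadpoleE m l : 2 < l <= m.+1 -> tadpole m.+1 l = [set tadpole_edge l i | i in 'I_m.+1].
Proof.
move=> /andP[l2 lm]; apply/setP => e; rewrite inE; apply/existsP/imsetP => [[i /existsP[j]]|[i _ ->]].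
  move=> /andP[/eqP-> /orP[/eqP ij|/andP[/eqP i0 /eqP jl]]].
    by exists i => //; rewrite /tadpole_edge -ltnS -ij ltn_ord inord_val.
  exists ord_max => //; rewrite /tadpole_edge ltnn -jl inord_val.
  by rewrite (_ : i = ord0) //; apply: val_inj.
rewrite /tadpole_edge; case: ifP => im.
  by exists i; apply/existsP; exists (inord i.+1); rewrite eqxx /= inordK // eqxx.
by exists ord0; apply/existsP; exists (inord l.-1); rewrite eqxx /= inordK ?eqxx ?orbT //; lia.
Qed.

Lemma iso_sym n (E1 E2 : graph n) : iso E1 E2 -> iso E2 E1.
Proof.
case=> f [injf <-]; exists (invF injf); split; first exact: can_inj (f_invF injf).
rewrite -imset_comp -[RHS]imset_id; apply: eq_imset => e /=.
by rewrite -imset_comp -[RHS]imset_id; apply: eq_imset => x /=; rewrite invF_f.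
Qed.

Lemma deg_iso n (E : graph n) (f : 'I_n -> 'I_n) v : injective f ->
  deg [set f @: (e : {set 'I_n}) | e in E] (f v) = deg E v.
Proof.
move=> injf; rewrite /deg -[RHS](card_imset _ (imset_inj injf)); apply: eq_card => e.
rewrite !inE; apply/andP/imsetP => [[/imsetP[e' e'E ->]]|[e']].
  by rewrite mem_imset // => ve'; exists e'; rewrite ?inE ?e'E.
by rewrite inE => /andP[e'E ve'] ->; rewrite imset_f ?mem_imset.
Qed.

(** A lasso through all vertices is an injective relabelling that sends the tadpole into [E]. The
    tadpole has [m + 1] edges and [E] has no more, so the image is all of [E]. *)
Lemma lasso_iso m (E : graph m.+1) l p :
  lasso E l p -> size p = m.+1 -> #|E| <= m.+1 -> iso E (tadpole m.+1 l).
Proof.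
case=> up lp stepE chordE szp cardE; apply: iso_sym; rewrite szp in lp stepE.
have injf : injective (fun i : 'I_m.+1 => nth ord0 p i).
  by move=> i j /eqP; rewrite nth_uniq ?szp // => /eqP/val_inj.
exists (fun i : 'I_m.+1 => nth ord0 p i); split=> //.
apply/eqP; rewrite eqEcard; apply/andP; split; last first.
  by rewrite (card_imset _ (imset_inj injf)) tadpoleE // card_imset ?card_ord //; apply: tadpole_edge_inj.
apply/subsetP => _ /imsetP[_ /[!tadpoleE]// /imsetP[i _ ->] ->].
rewrite /tadpole_edge; case: ifP => im; rewrite imsetU1 imset_set1 /= inordK //; last by lia.
  exact: stepE.
exact: chordE.
Qed.

Lemma sum_pred1 m v : \sum_(i < m) (v == i :> nat) = (v < m).
Proof. by elim: m => [|m IHm]; rewrite ?big_ord0 // big_ord_recr /= IHm; lia. Qed.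

Lemma sum_pred1S m v : \sum_(i < m) (v == i.+1 :> nat) = (0 < v <= m).
Proof. by elim: m => [|m IHm]; rewrite ?big_ord0 // ?big_ord_recr /= ?IHm; lia. Qed.

(** The chord gives vertex 0 the neighbour it lacks on the path and gives [l - 1] an extra one,
    while [m] has no successor. For [l = m + 1] the two corrections cancel. *)
Lemma deg_tadpole m l (v : 'I_m.+1) : 2 < l <= m.+1 ->
  deg (tadpole m.+1 l) v = 2 + (v == l.-1 :> nat) - (v == m :> nat).
Proof.
move=> lm; have /andP[l2 lm'] := lm.
have -> : deg (tadpole m.+1 l) v = \sum_i (v \in tadpole_edge l i).
  rewrite -[RHS]big_mkcond sum1dep_card -(card_imset _ (tadpole_edge_inj lm)) /deg tadpoleE //.
  apply: eq_card => e; rewrite !inE; apply/andP/imsetP => [[/imsetP[i _ ->] ve]|[i + ->]].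
    by exists i; rewrite ?inE.
  by rewrite inE imset_f.
rewrite big_ord_recr /= in_tadpole_edge //= ltnn.
under eq_bigr => i _.
  rewrite in_tadpole_edge //= ltn_ord (_ : nat_of_bool _ = (v == i :> nat) + (v == i.+1 :> nat)); last by lia.
  over.
by rewrite big_split /= sum_pred1 sum_pred1S; have := ltn_ord v; lia.
Qed.

Lemma simple_tadpole m l : 2 < l <= m.+1 -> simple_graph (tadpole m.+1 l).
Proof.
move=> lm e; rewrite tadpoleE // => /imsetP[i _ ->].
rewrite /tadpole_edge; case: ifP => im; rewrite cards2 -val_eqE /= inordK; lia.
Qed.

Lemma connected_tadpole m l : 2 < l <= m.+1 -> connected (tadpole m.+1 l).
Proof.
move=> lm; have c0 k : k < m.+1 -> connect (adj (tadpole m.+1 l)) ord0 (inord k).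
  elim: k => [|k IHk] km; first by rewrite (_ : inord 0 = ord0) //; apply: val_inj; rewrite /= inordK.
  apply: connect_trans (IHk (ltnW km)) (connect1 _).
  rewrite /adj tadpoleE //; apply/imsetP; exists (inord k) => //.
  by rewrite /tadpole_edge inordK ?(ltnW km) // -ltnS km.
move=> u v; apply: (@connect_trans _ _ ord0); last by rewrite -[v]inord_val c0.
by rewrite (sym_connect_sym (@adj_sym _ _)) -[u]inord_val c0.
Qed.

Lemma next_nth_uniq (T : eqType) x0 (p : seq T) i : uniq p -> i < size p ->
  next p (nth x0 p i) = nth x0 p (if i.+1 < size p then i.+1 else 0).
Proof.
move=> up ip; rewrite next_nth mem_nth //; case: p up ip => // y p up ip; rewrite index_uniq //=.
rewrite ltnS; case: ltnP => [ip'|pi] /=; first exact: set_nth_default.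
by rewrite nth_default.
Qed.

Lemma lasso_tadpole m l : 2 < l <= m.+1 -> lasso (tadpole m.+1 l) l (enum 'I_m.+1).
Proof.
move=> lm; have /andP[l2 lm'] := lm.
have adjT (i : 'I_m.+1) u v : tadpole_edge l i = [set u; v] -> adj (tadpole m.+1 l) u v.
  by move=> def_i; rewrite /adj tadpoleE // -def_i imset_f.
have nthE x0 k : k < m.+1 -> nth x0 (enum 'I_m.+1) k = inord k.
  by move=> km; apply: val_inj; rewrite /= nth_enum_ord ?inordK.
split; rewrite ?enum_uniq ?size_enum_ord // => x0.
  move=> i im; apply: (adjT (inord i)).
  by rewrite /tadpole_edge !nthE ?(ltnW im) // inordK ?(ltnW im) // -ltnS im.
apply: (adjT ord_max); rewrite /tadpole_edge ltnn !nthE //; last by lia.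
by rewrite -[ord0]inord_val.
Qed.

(** No cycle uses an edge of the tail, so every cycle lies inside the obvious one, [K], and equals
    it by [cycle_eq]. *)
Lemma unicyclic_tadpole m l : 2 < l <= m.+1 -> unicyclic (tadpole m.+1 l).
Proof.
move=> lm; have /andP[l2 lm'] := lm; split; first exact: connected_tadpole.
have lassoT := lasso_tadpole lm; have cycK := lasso_cycle lassoT.
set K := cycle_edges _ in cycK; exists K; split=> // C' [C'T C'0 dC' cC'].
have sT := simple_tadpole lm.
have szt : size (take l (enum 'I_m.+1)) = l by rewrite size_takel ?size_enum_ord.
have ut : uniq (take l (enum 'I_m.+1)) by rewrite take_uniq ?enum_uniq.
have KE i : i < l -> [set inord i; inord (if i.+1 < l then i.+1 else 0)] \in K.
  move=> il; have ntE k : k < l -> nth ord0 (take l (enum 'I_m.+1)) k = inord k.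
    by move=> kl; rewrite nth_take //; apply: val_inj; rewrite /= nth_enum_ord ?inordK //; lia.
  apply/imsetP; exists (inord i); first by rewrite -ntE // mem_nth ?szt.
  by rewrite -{3}[inord i]ntE // next_nth_uniq ?szt // ntE //; case: ifP; lia.
(* Induction from the free end of the tail: once the later edges are excluded, vertex [i + 1] would
   have degree at most 1 in [C']. *)
have tailP k (i : 'I_m.+1) : m - i < k -> l.-1 <= i -> i < m -> tadpole_edge l i \notin C'.
  elim: k i => // k IHk i ik li im; apply/negP => iC'.
  have v_i : inord i.+1 \in tadpole_edge l i.
    by rewrite in_tadpole_edge // im inordK ?eqxx ?orbT.
  case: (dC' (inord i.+1)) (deg_gt0 iC' v_i) => [-> //|dv _].
  suff : deg C' (inord i.+1) <= 1 by rewrite dv.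
  rewrite -(cards1 (tadpole_edge l i)); apply/subset_leq_card/subsetP => e.
  rewrite !inE => /andP[eC']; have := subsetP C'T e eC'; rewrite tadpoleE // => /imsetP[j _ def_e].
  rewrite def_e in eC' *; rewrite in_tadpole_edge // inordK //; case: ifP => jm.
    case/pred2P => [ij|[/val_inj->]] //; have := IHk j; rewrite eC'; lia.
  by move=> /pred2P[]; lia.
case: cycK => KT K0 dK cK; apply: cycle_eq => //; first exact: simple_sub KT sT; last first.
  by move=> v; case: (dK v) => ->.
apply/subsetP => e eC'; have := subsetP C'T e eC'; rewrite tadpoleE // => /imsetP[i _ def_e].
have : tadpole_edge l i \in C' by rewrite -def_e.
rewrite {}def_e {eC'} => iC'; have := tailP _ i (ltnSn _); rewrite iC' /tadpole_edge.
case: ifP => im tail.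
  have il : i.+1 < l by apply: contraT; rewrite -leqNgt => li; apply: tail => //; lia.
  by have := KE i; rewrite il inord_val; apply; apply: ltnW.
(* The chord is the closing edge of [K], from position [l - 1] back to 0. *)
have := KE l.-1; rewrite prednK; last by lia.
by rewrite ltnn setUC leqnn => /(_ isT); rewrite -[ord0]inord_val.
Qed.

Lemma unicyclic_lasso n (E : graph n) : 2 < n -> simple_graph E -> unicyclic E ->
  exists l p, lasso E l p.
Proof.
move=> n2 sE [cE [C [[CE C0 dC cC] _]]].
have [|l [p [up lp stepE chordE]]] := exists_lasso (simple_sub CE sE) C0.
  by move=> v; case: (dC v) => ->.
exists l, p; split=> // *; apply: (subsetP CE); [exact: stepE | exact: chordE].
Qed.

Lemma iso_tadpole m (E : graph m.+1) : 2 < m.+1 -> simple_graph E -> unicyclic E ->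
    (forall v, deg E v <= 3) -> (forall u v, 2 < deg E u -> 2 < deg E v -> u = v) ->
  exists2 l, 2 < l <= m.+1 & iso E (tadpole m.+1 l).
Proof.
move=> m2 sE uE d3 u3; have [l0 [p0 lasso0]] := unicyclic_lasso m2 sE uE.
have [l [p [lasso_p szp]]] := hamiltonian_lasso sE uE.1 d3 u3 lasso0.
exists l; last exact: lasso_iso lasso_p szp (unicyclic_card _ sE uE).
by case: lasso_p => _; rewrite szp.
Qed.

(** * The weight of an edge *)

Open Scope R_scope.

Lemma bernoulli_le1 b u : 0 <= b <= 1 -> 0 < u -> Rpower u b <= 1 + b * (u - 1).
Proof.
move=> [b0 b1] u0; rewrite /Rpower; set A := 1 + b * (u - 1).
have A0 : 0 < A by rewrite /A; nra.
have lnle w : 0 < w -> ln w <= w - 1.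
  by move=> w0; have := exp_ineq1_le (ln w); rewrite exp_ln //; lra.
rewrite -(exp_ln A A0).
(* concavity of ln at u / A and 1 / A, whose weighted mean is 1 *)
have H : b * ln u <= ln A.
  have A1 : 0 < / A by apply: Rinv_0_lt_compat.
  have := lnle (u * / A) (Rmult_lt_0_compat _ _ u0 A1); have := lnle (/ A) A1.
  rewrite ln_mult // ln_Rinv // => H1 H2.
  have E : b * (u * / A - 1) + (1 - b) * (/ A - 1) = 0 by rewrite /A in A0 *; field; lra.
  nra.
by case: H => [H|->]; [left; apply: exp_increasing | right].
Qed.

(** In the variable t = 1/s the power is t^(-alpha), which is concave; the right side is its tangent
    at t = 1/a. *)
Lemma Rpower_tangent alpha a s : -1 <= alpha < 0 -> 0 < a -> 0 < s ->
  Rpower s alpha <= Rpower a alpha * (1 + - alpha * (a / s - 1)).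
Proof.
move=> ha a0 s0.
have -> : Rpower s alpha = Rpower a alpha * Rpower (a / s) (- alpha).
  rewrite /Rpower -exp_plus /Rdiv ln_mult // ?ln_Rinv //; last exact: Rinv_0_lt_compat.
  by congr exp; ring.
apply: Rmult_le_compat_l; first by left; apply: exp_pos.
by apply: bernoulli_le1; [lra | apply: Rdiv_lt_0_compat].
Qed.

Lemma Rpower_gap34_gt0 alpha : -1 <= alpha < 0 -> 0 < Rpower 3 alpha - Rpower 4 alpha.
Proof.
move=> ha; have : 0 < Rpower 3 alpha by apply: exp_pos.
have := @Rpower_tangent alpha 3 4 ha ltac:(lra) ltac:(lra); nra.
Qed.

Lemma Rpower_gap34_le alpha : -1 <= alpha < 0 ->
  3 * (Rpower 3 alpha - Rpower 4 alpha) <= - alpha * Rpower 4 alpha.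
Proof. by move=> ha; have := @Rpower_tangent alpha 4 3 ha ltac:(lra) ltac:(lra); lra. Qed.

(** The difference f(4) - 2g is the price of each edge short of [n] in [chi_bound]; it must be
    positive. *)
Lemma Rpower_gap34_small alpha : -1 <= alpha < 0 ->
  2 * (Rpower 3 alpha - Rpower 4 alpha) < Rpower 4 alpha.
Proof.
move=> ha; have : 0 < Rpower 4 alpha by apply: exp_pos.
have := Rpower_gap34_le ha; nra.
Qed.

(** The tangent at 4, evaluated at 3 and at 5, separates the two gaps. It follows that sigma is at
    least 4g/15. *)
Lemma Rpower_gap45_ge alpha : -1 <= alpha < 0 ->
  3 * (Rpower 3 alpha - Rpower 4 alpha) <= 5 * (Rpower 4 alpha - Rpower 5 alpha).
Proof.
move=> ha; have := Rpower_gap34_le ha.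
have := @Rpower_tangent alpha 4 5 ha ltac:(lra) ltac:(lra); lra.
Qed.

(** Here the power is seen as a convex exponential in ln s; strictness comes from 3 * 5 < 4 * 4. *)
Lemma Rpower_gap45_lt_gap34 alpha : alpha < 0 ->
  Rpower 4 alpha - Rpower 5 alpha < Rpower 3 alpha - Rpower 4 alpha.
Proof.
move=> a0; have F s : Rpower 4 alpha * (1 + alpha * (ln s - ln 4)) <= Rpower s alpha.
  have -> : Rpower s alpha = Rpower 4 alpha * exp (alpha * (ln s - ln 4)).
    by rewrite /Rpower -exp_plus; congr exp; ring.
  by apply: Rmult_le_compat_l; [left; apply: exp_pos | apply: exp_ineq1_le].
have L : ln 3 + ln 5 < ln 4 + ln 4.
  by rewrite -!ln_mult; try lra; apply: ln_increasing; lra.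
have : 0 < Rpower 4 alpha by apply: exp_pos.
have : 0 < alpha * (ln 3 + ln 5 - (ln 4 + ln 4)) by nra.
have := F 3; have := F 5; nra.
Qed.

(** The factor 12g is the slope of f in 1/s between s = 4 and s = 3. By concavity it is at most 20h,
    the slope between 5 and 4, and this is at most the slope of the tangent at 5. *)
Lemma Rpower_gap5_ge alpha s : -1 <= alpha < 0 -> 5 <= s ->
  12 * (Rpower 3 alpha - Rpower 4 alpha) * (/ 5 - / s) <= Rpower 5 alpha - Rpower s alpha.
Proof.
move=> ha s5; have := Rpower_gap45_ge ha.
have := @Rpower_tangent alpha 5 4 ha ltac:(lra) ltac:(lra).
have := @Rpower_tangent alpha 5 s ha ltac:(lra) ltac:(lra).
have I : 0 <= / 5 - / s by have := Rinv_le_contravar 5 s ltac:(lra) s5; lra.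
have -> : 5 / s - 1 = - 5 * (/ 5 - / s) by field; lra.
nra.
Qed.

(** With s = x + y, [Rpower_gap5_ge] and the bound 1/x + 1/y >= 4/s make the right side at least h +
    2g/5 - 4g/s. For s >= 6 this is at least h - 4g/15, which exceeds h - g/3. *)
Lemma edge_bound_ge6 alpha x y : -1 <= alpha < 0 -> 0 < x -> 0 < y -> 6 <= x + y ->
  (Rpower 4 alpha - Rpower 5 alpha) - (Rpower 3 alpha - Rpower 4 alpha) / 3 <
  Rpower 4 alpha - 2 * (Rpower 3 alpha - Rpower 4 alpha) * (1 - (/ x + / y)) - Rpower (x + y) alpha.
Proof.
move=> ha x0 y0 s6.
have g0 := Rpower_gap34_gt0 ha; have := @Rpower_gap5_ge alpha (x + y) ha ltac:(lra).
(* AM-HM *)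
have A : 4 * / (x + y) <= / x + / y.
  have E : / x + / y - 4 * / (x + y) = (x - y) * (x - y) * / (x * y * (x + y)) by field; lra.
  suff : 0 <= (x - y) * (x - y) * / (x * y * (x + y)) by lra.
  apply: Rmult_le_pos; first exact: Rle_0_sqr.
  by left; apply: Rinv_0_lt_compat; apply: Rmult_lt_0_compat; nra.
have B : / (x + y) <= / 6 by apply: Rinv_le_contravar; lra.
nra.
Qed.

(** * The index *)

Lemma RplusA : associative Rplus.
Proof. by move=> x y z; rewrite Rplus_assoc. Qed.

HB.instance Definition _ := Monoid.isComLaw.Build R R0 Rplus RplusA Rplus_comm Rplus_0_l.


Lemma Rsum_const (I : finType) (P : pred I) c : \big[Rplus/R0]_(i | P i) c = INR #|P| * c.
Proof.
rewrite big_const; elim: #|P| => [|k IHk]; first by rewrite /= Rmult_0_l.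
by rewrite iterS IHk S_INR; lra.
Qed.

Lemma Rsum_const_set (I : finType) (A : {set I}) c : \big[Rplus/R0]_(i in A) c = INR #|A| * c.
Proof. exact: Rsum_const. Qed.

Lemma Rsum_mull (I : finType) (P : pred I) c F :
  \big[Rplus/R0]_(i | P i) (c * F i) = c * \big[Rplus/R0]_(i | P i) F i.
Proof.
by rewrite (big_endo (Rmult c)) ?Rmult_0_r // => x y; rewrite Rmult_plus_distr_l.
Qed.

Lemma Rsum_le (I : finType) (P : pred I) F G : (forall i, P i -> F i <= G i) ->
  \big[Rplus/R0]_(i | P i) F i <= \big[Rplus/R0]_(i | P i) G i.
Proof. by move=> le_FG; apply: (big_ind2 Rle) => // *; [lra | apply: Rplus_le_compat]. Qed.

Lemma Rsum_lt (I : finType) (P : pred I) F G i : (forall i, P i -> F i <= G i) -> P i -> F i < G i ->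
  \big[Rplus/R0]_(i | P i) F i < \big[Rplus/R0]_(i | P i) G i.
Proof.
move=> le_FG Pi lt_i; rewrite !(bigD1 i Pi) /=; apply: Rplus_lt_le_compat => //.
by apply: Rsum_le => j /andP[/le_FG].
Qed.

Lemma Rsum_delta m k c : (k < m)%N -> \big[Rplus/R0]_(i < m) (if i == k :> nat then c else 0) = c.
Proof.
by move=> km; rewrite -big_mkcond (big_pred1 (Ordinal km)).
Qed.

Lemma big_set2 (I : finType) (S : Type) idx (op : Monoid.com_law idx) (F : I -> S) u v :
  u != v -> \big[op/idx]_(i in [set u; v]) F i = op (F u) (F v).
Proof. by move=> uv; rewrite big_setU1 ?inE // big_set1. Qed.

Lemma chi_iso alpha n (E1 E2 : graph n) : iso E1 E2 -> chi alpha E1 = chi alpha E2.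
Proof.
case=> f [injf <-]; rewrite /chi big_imset /=; last by move=> ? ? _ _; apply: imset_inj.
apply: eq_bigr => e eE; rewrite big_imset /=; last by move=> ? ? _ _; apply: injf.
by congr (Rpower (INR _) _); apply: eq_bigr => v _; rewrite deg_iso.
Qed.

(** Double counting of incidences. Taking F = 1/deg turns the correction terms of the edge weights
    into a sum of ones over the vertices. *)
Lemma Rsum_edges n (E : graph n) (F : 'I_n -> R) :
  \big[Rplus/R0]_(e in E) \big[Rplus/R0]_(v in e) F v = \big[Rplus/R0]_v (INR (deg E v) * F v).
Proof.
rewrite (exchange_big_dep predT) //=; apply: eq_bigr => v _.
by rewrite Rsum_const; congr (INR _ * _); rewrite /deg cardsE.
Qed.

(** From degree sum 6 on, one end has degree at least 3 and [edge_bound_ge6] applies. Of the five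
    smaller pairs, (1, 2), (2, 2) and (2, 3) give equality; these are the edge types of a tadpole
    whose tail has at least two vertices. *)
Lemma edge_bound alpha x y : -1 <= alpha < 0 -> (0 < x)%N -> (0 < y)%N -> (2 < x + y)%N ->
  let f s := Rpower s alpha in
  let B := f 4 - 2 * (f 3 - f 4) * (1 - (/ INR x + / INR y))
   - (if (2 < x)%N || (2 < y)%N then (f 4 - f 5) - (f 3 - f 4) / 3 else 0) in
  f (INR (x + y)) <= B /\ ((5 < x + y)%N -> f (INR (x + y)) < B).
Proof.
move=> ha; wlog xy : x y / (x <= y)%N.
  move=> W x0 y0 s3; have [/W|/ltnW/W] := leqP x y; first exact.
  by rewrite addnC orbC [/ INR y + _]Rplus_comm; apply.
move=> x0 y0 s3 f B; have := Rpower_gap34_gt0 ha; have := Rpower_gap45_lt_gap34 (proj2 ha); rewrite -!/(f _) => gh g0.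
have [s6|s5] := ltnP 5 (x + y); last first.
  split=> //.
  have [[ex ey]|[[ex ey]|[[ex ey]|[[ex ey]|[ex ey]]]]] :
    (x = 1 /\ y = 2 \/ x = 1 /\ y = 3 \/ x = 1 /\ y = 4 \/ x = 2 /\ y = 2 \/ x = 2 /\ y = 3)%N by lia.
  - rewrite /B ex ey !INR_IZR_INZ /=; lra.
  - rewrite /B ex ey !INR_IZR_INZ /=; lra.
  - rewrite /B ex ey !INR_IZR_INZ /=; lra.
  - rewrite /B ex ey !INR_IZR_INZ /=; lra.
  - rewrite /B ex ey !INR_IZR_INZ /=; lra.
suff lt_B : f (INR (x + y)) < B by split; [left|].
have X0 : 0 < INR x by apply: lt_0_INR; apply/ltP.
have Y0 : 0 < INR y by apply: lt_0_INR; apply/ltP.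
have S6 : 6 <= INR x + INR y.
  by rewrite -plus_INR (_ : 6 = INR 6); [apply: le_INR; apply/leP | rewrite /=; lra].
have := edge_bound_ge6 ha X0 Y0 S6; rewrite -plus_INR /B -!/(f _).
have -> : ((2 < x) || (2 < y))%N by lia.
rewrite -[(x + y)%coq_nat]/(x + y)%N; lra.
Qed.

(** These are the edges on which [edge_bound] gains sigma. *)
Definition touching n (E : graph n) : graph n := [set e in E | [exists v in e, (2 < deg E v)%N]].

Lemma chi_bound alpha n (E : graph n) :
    -1 <= alpha < 0 -> (2 < n)%N -> simple_graph E -> connected E -> (#|E| <= n)%N ->
  let f s := Rpower s alpha in
  let B := INR n * f 4 - INR #|touching E| * ((f 4 - f 5) - (f 3 - f 4) / 3) in
  chi alpha E <= B /\
  ((exists2 e, e \in E & (5 < \sum_(v in e) deg E v)%N) -> chi alpha E < B).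
Proof.
move=> ha n2 sE cE cardE f B.
have d0 v : (0 < deg E v)%N by apply: connected_deg_gt0 (ltnW n2) sE cE.
pose b (e : {set 'I_n}) := f 4 - 2 * (f 3 - f 4) + 2 * (f 3 - f 4) * \big[Rplus/R0]_(v in e) / INR (deg E v)
  + (if [exists v in e, (2 < deg E v)%N] then - ((f 4 - f 5) - (f 3 - f 4) / 3) else 0).
have edgeB e : e \in E -> f (INR (\sum_(v in e) deg E v)) <= b e /\
    ((5 < \sum_(v in e) deg E v)%N -> f (INR (\sum_(v in e) deg E v)) < b e).
  move=> eE; have [u [v [uv def_e uvE]]] := edgeP sE eE.
  have := edge_bound ha (d0 u) (d0 v) (connected_edge_deg n2 sE cE uvE).
  rewrite /b def_e !big_set2 //=.
  have -> : [exists w in [set u; v], (2 < deg E w)%N] = ((2 < deg E u) || (2 < deg E v))%N.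
    apply/existsP/orP => [[w]|[dw|dw]]; last 2 first.
    - by exists u; rewrite !inE eqxx.
    - by exists v; rewrite !inE eqxx orbT.
    by rewrite !inE => /andP[/pred2P[]->]; [left | right].
  by case: ifP => _; rewrite -!/(f _); case=> H1 H2; split=> [|/H2]; lra.
have sum_b : \big[Rplus/R0]_(e in E) b e <= B.
  have sum_t : \big[Rplus/R0]_(e in E) (if [exists v in e, (2 < deg E v)%N]
      then - ((f 4 - f 5) - (f 3 - f 4) / 3) else 0)
      = INR #|touching E| * - ((f 4 - f 5) - (f 3 - f 4) / 3).
    by rewrite -big_mkcondr Rsum_const; congr (INR _ * _); apply: eq_card => e; rewrite inE.
  rewrite !big_split /= sum_t !Rsum_const_set Rsum_mull Rsum_edges.
  have -> : \big[Rplus/R0]_v (INR (deg E v) * / INR (deg E v)) = INR n.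
    rewrite (eq_bigr (fun=> 1)) => [|v _]; first by rewrite Rsum_const cardT size_enum_ord; lra.
    by rewrite Rinv_r //; apply: not_0_INR => dv; have := d0 v; rewrite dv.
  rewrite /B.
  have /le_INR leE : (#|E| <= n)%coq_nat by apply/leP.
  have := Rpower_gap34_small ha; rewrite -!/(f _) => fs.
  (* The sum of the bounds is |E| (f(4) - 2g) + 2gn minus the sigma terms; replacing |E| by [n] can
     only increase it. *)
  have : 0 <= (INR n - INR #|E|) * (f 4 - 2 * (f 3 - f 4)) by apply: Rmult_le_pos; lra.
  by move: (f 3) (f 4) (f 5) (INR n) (INR #|E|) (INR #|touching E|) => *; lra.
split; first by apply: Rle_trans sum_b; apply: Rsum_le => e /edgeB[].
case=> e eE s6; apply: Rlt_le_trans sum_b; apply: (Rsum_lt (i := e)) => [e'|//|].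
  by move=> /edgeB[].
by apply: (edgeB e eE).2.
Qed.

Lemma leq_touching n (E : graph n) v : (2 < deg E v)%N -> (deg E v <= #|touching E|)%N.
Proof.
move=> dv; apply/subset_leq_card/subsetP => e; rewrite !inE => /andP[-> ve] /=.
by apply/existsP; exists v; rewrite ve.
Qed.

(** The cases are a tail of at least two vertices, a single pendant vertex, and the cycle. *)
Definition tadpole_chi alpha n l :=
  let f s := Rpower s alpha in
  if (l < n.-1)%N then INR (n - 4) * f 4 + 3 * f 5 + f 3
  else if (l < n)%N then INR (n - 2) * f 4 + 2 * f 5 else INR n * f 4.

Lemma chi_tadpole alpha m l : (2 < m)%N -> (2 < l <= m.+1)%N ->
  chi alpha (tadpole m.+1 l) = tadpole_chi alpha m.+1 l.
Proof.
move=> m2 lm; have /andP[l2 lm'] := lm.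
rewrite /chi {1}tadpoleE // big_imset /=; last by move=> ? ? _ _; apply: tadpole_edge_inj.
rewrite big_ord_recr /=.
(* Only the degree sums 3, 4 and 5 occur, so the default branch stands for 4. *)
pose c k := if k == 3%N then Rpower 3 alpha else if k == 5%N then Rpower 5 alpha else Rpower 4 alpha.
have fc k : (2 < k < 6)%N -> Rpower (INR k) alpha = c k.
  rewrite /c INR_IZR_INZ => k36.
  by have [->|[->|->]] : (k = 3 \/ k = 4 \/ k = 5)%N by lia.
have -> : \big[Rplus/R0]_(i < m)
    Rpower (INR (\sum_(v in tadpole_edge l (widen_ord (leqnSn m) i)) deg (tadpole m.+1 l) v)) alpha
  = \big[Rplus/R0]_(i < m) c (4 + (i == l.-1 :> nat) + (i == l.-2 :> nat) - (i == m.-1 :> nat))%N.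
  apply: eq_bigr => i _; have im := ltn_ord i.
  have v_neq : widen_ord (leqnSn m) i != inord i.+1 by rewrite -val_eqE /= inordK //; lia.
  rewrite /tadpole_edge /= im big_set2 // !deg_tadpole //= inordK // -fc; last by lia.
  by congr (Rpower (INR _) _); lia.
have -> : Rpower (INR (\sum_(v in tadpole_edge l (@ord_max m)) deg (tadpole m.+1 l) v)) alpha
  = c (5 - (l == m.+1))%N.
  have v_neq : @ord0 m != inord l.-1 by rewrite -val_eqE /= inordK; lia.
  rewrite /tadpole_edge /= ltnn big_set2 // !deg_tadpole //= inordK; last by lia.
  by rewrite -fc; [congr (Rpower (INR _) _) |]; lia.
rewrite /tadpole_chi -[m.+1.-1]/m; case: ifP => [lt_lm|].
  have -> : (l == m.+1) = false by lia.
  have E (i : 'I_m) : c (4 + (i == l.-1 :> nat) + (i == l.-2 :> nat) - (i == m.-1 :> nat))%N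
    = Rpower 4 alpha + ((if i == l.-1 :> nat then Rpower 5 alpha - Rpower 4 alpha else 0)
    + ((if i == l.-2 :> nat then Rpower 5 alpha - Rpower 4 alpha else 0)
    + (if i == m.-1 :> nat then Rpower 3 alpha - Rpower 4 alpha else 0))).
    rewrite /c; case: (eqVneq (i : nat) l.-1) => ?; case: (eqVneq (i : nat) l.-2) => ?;
      case: (eqVneq (i : nat) m.-1) => ?; rewrite /=; try lia; lra.
  under eq_bigr => i _ do rewrite E.
  rewrite !big_split /= Rsum_const !Rsum_delta; try lia.
  rewrite cardT size_enum_ord /c /= (_ : m.+1 - 4 = m - 3)%N // minus_INR; last by apply/leP.
  by rewrite /=; lra.
move=> ge_lm; case: ifP => [lt_lm|].
  have -> : (l == m.+1) = false by lia.
  (* The pendant edge joins degrees 3 and 1, so its corrections cancel and its sum is 4. *)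
  have E (i : 'I_m) : c (4 + (i == l.-1 :> nat) + (i == l.-2 :> nat) - (i == m.-1 :> nat))%N
    = Rpower 4 alpha + (if i == l.-2 :> nat then Rpower 5 alpha - Rpower 4 alpha else 0).
    have -> : l = m by lia.
    rewrite /c; case: (eqVneq (i : nat) m.-1) => ?; case: (eqVneq (i : nat) m.-2) => ?; rewrite /=; try lia; lra.
  under eq_bigr => i _ do rewrite E.
  rewrite !big_split /= Rsum_const !Rsum_delta; try lia.
  rewrite cardT size_enum_ord /c /= (_ : m.+1 - 2 = m - 1)%N // minus_INR; last by apply/leP; lia.
  by rewrite /=; lra.
move=> ge_lm'; have -> : l = m.+1 by lia.
rewrite eqxx; under eq_bigr => i _.
  rewrite (_ : (4 + _ + _ - _) = 4)%N; last by rewrite /=; have := ltn_ord i; lia.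
  over.
by rewrite Rsum_const cardT size_enum_ord /c S_INR /=; lra.
Qed.

(** * Largest and second largest values *)

Lemma Rpower_gaps alpha : -1 <= alpha < 0 ->
  [/\ 0 < Rpower 4 alpha - Rpower 5 alpha,
      Rpower 4 alpha - Rpower 5 alpha < Rpower 3 alpha - Rpower 4 alpha
    & 0 < (Rpower 4 alpha - Rpower 5 alpha) - (Rpower 3 alpha - Rpower 4 alpha) / 3].
Proof.
move=> ha; have := Rpower_gap34_gt0 ha; have := Rpower_gap45_ge ha.
by have := Rpower_gap45_lt_gap34 (proj2 ha); split; lra.
Qed.

Lemma tadpole_chi_cycle alpha n : tadpole_chi alpha n n = INR n * Rpower 4 alpha.
Proof. by rewrite /tadpole_chi ltnn ltnNge leq_pred. Qed.

Lemma tadpole_chi_lt alpha n l : -1 <= alpha < 0 -> (3 < n)%N -> (l < n)%N ->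
  tadpole_chi alpha n l < INR n * Rpower 4 alpha.
Proof.
move=> ha n3 ln; have [h0 gh s0] := Rpower_gaps ha; rewrite /tadpole_chi ln.
rewrite !minus_INR; try (apply/leP; lia).
by case: ifP => _; rewrite /=; lra.
Qed.

(** The graph is isomorphic to some tadpole; with a nonempty tail, vertex [l - 1] would have degree
    3. *)
Lemma deg_le2_iso_cycle n (E : graph n) : (3 < n)%N -> simple_graph E -> unicyclic E ->
  (forall v, deg E v <= 2)%N -> iso E (cycle_graph n).
Proof.
case: n E => // m E m3 sE uE d2.
have [|v|u v du|l lm isoE] := @iso_tadpole m E _ sE uE; first exact: ltnW.
- exact: leq_trans (d2 v) _.
- by have := d2 u; rewrite leqNgt du.
rewrite /cycle_graph; have [l_eq|l_neq] := eqVneq l m.+1; first by rewrite l_eq in isoE.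
case: isoE => f [injf defT]; have [g fg gf] := injF_bij injf.
have := deg_iso E (g (inord l.-1)) injf; rewrite defT gf deg_tadpole // inordK; last by lia.
by have := d2 (g (inord l.-1)); rewrite eqxx; lia.
Qed.

Lemma deg_lt n (E : graph n) v : simple_graph E -> (deg E v < n)%N.
Proof.
move=> sE; rewrite deg_nbrs // -[X in (_ < X)%N](card_ord n) -cardsT; apply/proper_card/properP.
by split; [apply: subsetT | exists v; rewrite ?inE //; apply/negP => /(adj_neq sE); rewrite eqxx].
Qed.

(** The vertex [v] lies on at least three touching edges, which costs 3 sigma. Equality leaves
    exactly three of them and no edge of degree sum above 5. Two vertices of degree at least 3 would
    share all three, hence be adjacent with degree sum at least 6. *)
Lemma chi_le_second alpha n (E : graph n) v :
    -1 <= alpha < 0 -> (3 < n)%N -> simple_graph E -> unicyclic E -> (2 < deg E v)%N ->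
  let f s := Rpower s alpha in
  let B := INR (n - 4) * f 4 + 3 * f 5 + f 3 in
  chi alpha E <= B /\ (chi alpha E = B ->
    (forall w, deg E w <= 3)%N /\ forall u w, (2 < deg E u)%N -> (2 < deg E w)%N -> u = w).
Proof.
move=> ha n3 sE uE dv f B; have [h0 gh s0] := Rpower_gaps ha.
have [] := chi_bound ha (ltnW n3) sE uE.1 (unicyclic_card (ltnW (ltnW (ltnW n3))) sE uE).
rewrite -!/(f _) in h0 gh s0 *.
have -> : B = INR n * f 4 - 3 * (f 4 - f 5 - (f 3 - f 4) / 3).
  by rewrite /B minus_INR /=; [lra | apply/leP].
have touchE k : (k <= #|touching E|)%N -> INR k <= INR #|touching E|.
  by move=> /leP/le_INR.
have touch3 : 3 <= INR #|touching E|.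
  by have := touchE 3%N (leq_trans dv (leq_touching dv)); rewrite /=; lra.
move=> chi_le chi_lt; split; first by nra.
move=> chi_eq; have touch_le3 : (#|touching E| <= 3)%N.
  by rewrite leqNgt; apply/negP => /touchE; rewrite [INR 4]/=; nra.
have edge_le5 e : e \in E -> (\sum_(v in e) deg E v <= 5)%N.
  by move=> eE; rewrite leqNgt; apply/negP => e6; have := chi_lt (ex_intro2 _ _ e eE e6); nra.
split=> [w|u w du dw].
  by have [//|/leq_touching/leq_trans] := leqP (deg E w) 2; [exact: leqW | apply].
apply/eqP; apply: contraT => uw.
have touch_at z : (2 < deg E z)%N -> [set e in E | z \in e] = touching E.
  move=> dz; apply/eqP; rewrite eqEcard (leq_trans touch_le3 dz) andbT.
  apply/subsetP => e; rewrite !inE => /andP[-> ze] /=.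
  by apply/existsP; exists z; rewrite ze.
have /card_gt0P[e e_u] : (0 < deg E u)%N by apply: leq_trans du.
have : e \in [set e in E | w \in e] by rewrite (touch_at w dw) -(touch_at u du).
move: e_u; rewrite !inE => /andP[eE ue] /andP[_ we].
have := edge_le5 e eE; rewrite (bigD1 u) //= (bigD1 w) /= ?we 1?eq_sym //.
lia.
Qed.

(** Two vertices of degree 3 share at most one edge, so together they would need five edges, while
    there are at most four. *)
Lemma deg_order4 (E : graph 4) : simple_graph E -> unicyclic E ->
  forall u v, (2 < deg E u)%N -> (2 < deg E v)%N -> u = v.
Proof.
move=> sE uE u v du dv; apply/eqP; apply: contraT => uv.
have : (#|[set e in E | u \in e] :&: [set e in E | v \in e]| <= #|[set [set u; v]]|)%N.
  apply/subset_leq_card/subsetP => e; rewrite !inE => /andP[/andP[eE ue] /andP[_ ve]].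
  by rewrite eq_sym eqEcard subUset !sub1set ue ve (sE e eE) cards2 uv.
have : (#|[set e in E | u \in e] :|: [set e in E | v \in e]| <= #|E|)%N.
  by apply/subset_leq_card/subsetP => e; rewrite !inE => /orP[]/andP[].
have := @unicyclic_card 4 E isT sE uE; have := cardsUI [set e in E | u \in e] [set e in E | v \in e].
by rewrite -!/(deg E _) cards1; lia.
Qed.

Theorem theorem3 (alpha : R) (n : nat) :
  -1 <= alpha < 0 -> (4 <= n)%N ->
  (* C_n is the unique maximum *)
  (simple_graph (cycle_graph n) /\ unicyclic (cycle_graph n) /\
   chi alpha (cycle_graph n) = INR n * Rpower 4 alpha /\
   forall E : graph n, simple_graph E -> unicyclic E ->
     chi alpha E <= INR n * Rpower 4 alpha /\
     (chi alpha E = INR n * Rpower 4 alpha <-> iso E (cycle_graph n)))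
  /\
  (* n = 4 : U_{4,3} is the unique second maximum *)
  (n = 4%N ->
   (simple_graph (tadpole n 3) /\ unicyclic (tadpole n 3) /\
    ~ iso (tadpole n 3) (cycle_graph n) /\
    chi alpha (tadpole n 3) = 2 * Rpower 4 alpha + 2 * Rpower 5 alpha) /\
   forall E : graph n, simple_graph E -> unicyclic E -> ~ iso E (cycle_graph n) ->
     chi alpha E <= 2 * Rpower 4 alpha + 2 * Rpower 5 alpha /\
     (chi alpha E = 2 * Rpower 4 alpha + 2 * Rpower 5 alpha <-> iso E (tadpole n 3)))
  /\
  (* n >= 5 : second maximum, attained exactly by C_l + P_{n-l}, 3 <= l <= n-2 *)
  ((5 <= n)%N ->
   (exists E : graph n, simple_graph E /\ unicyclic E /\ ~ iso E (cycle_graph n) /\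
      chi alpha E = INR (n - 4) * Rpower 4 alpha + 3 * Rpower 5 alpha + Rpower 3 alpha) /\
   forall E : graph n, simple_graph E -> unicyclic E -> ~ iso E (cycle_graph n) ->
     chi alpha E <= INR (n - 4) * Rpower 4 alpha + 3 * Rpower 5 alpha + Rpower 3 alpha /\
     (chi alpha E = INR (n - 4) * Rpower 4 alpha + 3 * Rpower 5 alpha + Rpower 3 alpha <->
      exists l : nat, (3 <= l)%N /\ (l <= n - 2)%N /\ iso E (tadpole n l))).
Proof.
move=> ha n4; have [h0 gh s0] := Rpower_gaps ha.
case: n n4 => // m m3.
have chiT l : (2 < l <= m.+1)%N -> chi alpha (tadpole m.+1 l) = tadpole_chi alpha m.+1 l.
  exact: chi_tadpole.
have chiC : chi alpha (cycle_graph m.+1) = INR m.+1 * Rpower 4 alpha.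
  by rewrite chiT ?tadpole_chi_cycle // (ltnW m3) leqnn.
have not_cycle l : (2 < l <= m)%N -> ~ iso (tadpole m.+1 l) (cycle_graph m.+1).
  move=> /andP[l2 lm] /(chi_iso alpha); rewrite chiC chiT ?l2 ?leqW //.
  by have := @tadpole_chi_lt alpha m.+1 l ha m3; rewrite ltnS lm => /(_ isT); lra.
have cycle_or_branch (E : graph m.+1) : simple_graph E -> unicyclic E ->
    iso E (cycle_graph m.+1) \/ exists v, (2 < deg E v)%N.
  move=> sE uE; case: (boolP [forall v, deg E v <= 2]%N) => [/forallP d2|].
    by left; apply: deg_le2_iso_cycle.
  by rewrite negb_forall => /existsP[v]; rewrite -ltnNge => dv; right; exists v.
have cm : (2 < m.+1 <= m.+1)%N by rewrite leqnn andbT ltnW.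
split; [|split].
- split; first exact: simple_tadpole; split; first exact: unicyclic_tadpole.
  split=> // E sE uE; have [isoE|[v dv]] := cycle_or_branch E sE uE.
    by rewrite (chi_iso alpha isoE) chiC; split; [right | split].
  have [+ _] := chi_le_second ha m3 sE uE dv.
  rewrite minus_INR; last exact/leP.
  move=> chi_le; have chi_lt : chi alpha E < INR m.+1 * Rpower 4 alpha.
    by move: chi_le; rewrite [INR 4]/=; lra.
  split; first by left.
  by split=> [|/(chi_iso alpha)]; rewrite ?chiC; lra.
- move=> m4; have {m4} em : m = 3%N by lia.
  subst m; have l3 : (2 < 3 <= 4)%N by [].
  have chi3 : chi alpha (tadpole 4 3) = 2 * Rpower 4 alpha + 2 * Rpower 5 alpha.
    by rewrite chiT // /tadpole_chi /=; lra.
  split.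
    split; first exact: simple_tadpole; split; first exact: unicyclic_tadpole.
    by split=> //; apply: not_cycle.
  (* On four vertices all degrees are at most 3, so every unicyclic graph is a tadpole with [l]
     equal to 3 or 4. *)
  move=> E sE uE ncE; suff isoE : iso E (tadpole 4 3).
    by rewrite (chi_iso alpha isoE) chi3; split; [right | split].
  have [v|l /andP[l2 l4] isoE] := @iso_tadpole 3 E isT sE uE _ (deg_order4 sE uE).
    by rewrite -ltnS deg_lt.
  have [l_eq|l_neq] := eqVneq l 4%N; first by rewrite l_eq in isoE.
  by have l_eq : l = 3%N; [lia | rewrite l_eq in isoE].
move=> m4; split.
  exists (tadpole m.+1 3); have l3 : (2 < 3 <= m.+1)%N by lia.
  split; first exact: simple_tadpole; split; first exact: unicyclic_tadpole.
  by split; [apply: not_cycle | rewrite chiT // /tadpole_chi (_ : 3 < m.+1.-1)%N].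
move=> E sE uE ncE; have [//|[v dv]] := cycle_or_branch E sE uE.
have [chi_le chi_eq] := chi_le_second ha m3 sE uE dv; split=> //; split=> [eqB|[l [l2 [lm isoE]]]].
  have [d3 u3] := chi_eq eqB.
  have [l /andP[l2 lm] isoE] := iso_tadpole (ltnW m3) sE uE d3 u3.
  exists l; split=> //; split=> //; rewrite leqNgt; apply/negP => l_gt.
  have [l_eq|l_neq] := eqVneq l m.+1; first by rewrite l_eq in isoE.
  (* What remains is [l = m], a single pendant vertex, whose index falls short of the claimed value
     by g - h > 0. *)
  move: eqB; rewrite (chi_iso alpha isoE) chiT ?l2 // /tadpole_chi.
  have -> : (l < m.+1.-1)%N = false by lia.
  have -> : (l < m.+1)%N by lia.
  by rewrite !minus_INR; [rewrite [INR 4]/= [INR 2]/=; lra | apply/leP; lia..].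
have lm1 : (l < m.+1.-1)%N by lia.
by rewrite (chi_iso alpha isoE) chiT /tadpole_chi ?lm1 // l2; lia.
Qed.
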